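(* Let $G$ be a graph. For any $x\in \mathbb{N}$ and any integer $y\geq -1$, $$Z_G(-x,y)=\sum_{(H,c_V,c_E)\in \mathcal{OPC}_{x,y+1}(G)} (-1)^{\mathrm{cc}(\mathrm{gr}_0(H))}.$$ For any $x\in \mathbb{N}$ and any integer $y\geq 1$, $$Z_G(-x,-y)=\sum_{(H,c_V,c_E)\in \mathcal{OPC}_{x,y-1}(G)} (-1)^{\mathrm{cc}(\mathrm{gr}_0(H))+|c_E^{-1}([y-1])|}.$$ Here, for $x,y\in\mathbb{N}$, $\mathcal{OPC}_{x,y}(G)$ denotes the set of triples $(H,c_V,c_E)$ such that $H$ is a totally acyclic partial orientation of $G$, and $c_V:V(G)\to[x]$ and $c_E:E(H)\to\{0,\ldots,y\}$ are maps such that for any $\{v,w\}\in E(H)$, $c_E(\{v,w\})\neq 0$ if and only if $c_V(v)=c_V(w)$.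
   Context: $\mathbb{N}=\{0,1,2,\ldots\}$ and $[n]=\{1,\ldots,n\}$, $[0]=\emptyset$. Graphs are finite and simple: $G=(V(G),E(G))$ with $E(G)$ a set of unordered pairs of distinct vertices; the empty graph is allowed. $\mathrm{cc}$ denotes the number of connected components, and for $F\subseteq E(G)$, $G_{\mid F}$ is the graph with vertex set $V(G)$ and edge set $F$. The Fortuin-Kasteleyn polynomial is $Z_G(X,Y)=\sum_{F\subseteq E(G)} X^{\mathrm{cc}(G_{\mid F})}Y^{|F|}$. A mixed graph is a triple $H=(V(H),E(H),A(H))$ with $V(H)$ a finite set, $E(H)$ a set of unordered pairs of distinct elements of $V(H)$ (edges), and $A(H)$ a set of ordered pairs of distinct elements of $V(H)$ (arcs), such that for all distinct $x,y\in V(H)$ at most one of $\{x,y\}\in E(H)$, $(x,y)\in A(H)$, $(y,x)\in A(H)$ holds. The simple graphs $\mathrm{gr}(H)$ and $\mathrm{gr}_0(H)$ both have vertex set $V(H)$, with $E(\mathrm{gr}(H))=E(H)\cup\{\{x,y\}\mid (x,y)\in A(H)\}$ and $E(\mathrm{gr}_0(H))=E(H)$. A partial orientation of $G$ is a mixed graph $H$ with $\mathrm{gr}(H)=G$. It is not totally acyclic if there is a sequence $(x_0,\ldots,x_n)$ of vertices with $n\ge 2$, $x_0=x_n$, such that for every $i\in[n]$, $\{x_{i-1},x_i\}\in E(H)$ or $(x_{i-1},x_i)\in A(H)$, and there is at least one $i$ with $(x_{i-1},x_i)\in A(H)$; otherwise it is totally acyclic. *)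

(* Defs.v *)
From HB Require Import structures.
From mathcomp Require Export all_boot all_order all_algebra.
From mathcomp Require Export boolp.

Set Implicit Arguments.
Unset Strict Implicit.
Unset Printing Implicit Defensive.

Import GRing.Theory.

(* A graph or a mixed graph is given on its vertex set T, a finType (possibly
   empty); an edge {x, y} is the two-element set [set x; y]. *)

Record sgraph (T : finType) := SGraph {
  edges :> {set {set T}};
  edgesP : [forall e in edges, #|e| == 2]
}.

HB.instance Definition _ (T : finType) := [isSub for @edges T].
HB.instance Definition _ (T : finType) := [Finite of sgraph T by <:].

(* The number of connected components of the graph (T, F). *)
Definition cc (T : finType) (F : {set {set T}}) : nat :=
  n_comp [rel v w | [set v; w] \in F] T.

Definition fk_poly (T : finType) (G : sgraph T) : {poly {poly int}} :=
  (\sum_(F : {set {set T}} | F \subset G) 'X ^+ cc F * 'Y ^+ #|F|)%R.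

Definition mixed_axiom (T : finType) (E : {set {set T}}) (A : {set T * T}) :=
  [&& [forall e in E, #|e| == 2],
      [forall a in A, a.1 != a.2] &
      [forall v, forall w, (v != w) ==>
        (([set v; w] \in E) + ((v, w) \in A) + ((w, v) \in A) <= 1)]].

Record mgraph (T : finType) := MGraph {
  mgraph_val : {set {set T}} * {set T * T};
  mgraphP : mixed_axiom mgraph_val.1 mgraph_val.2
}.

HB.instance Definition _ (T : finType) := [isSub for @mgraph_val T].
HB.instance Definition _ (T : finType) := [Finite of mgraph T by <:].

Definition medges (T : finType) (H : mgraph T) : {set {set T}} :=
  (mgraph_val H).1.
Definition marcs (T : finType) (H : mgraph T) : {set T * T} :=
  (mgraph_val H).2.

Fact gr0_subproof (T : finType) (H : mgraph T) :
  [forall e in medges H, #|e| == 2].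
Proof. by case/and3P: (mgraphP H). Qed.

Definition gr0 (T : finType) (H : mgraph T) : sgraph T :=
  SGraph (gr0_subproof H).

Fact gr_subproof (T : finType) (H : mgraph T) :
  [forall e in medges H :|: [set [set a.1; a.2] | a in marcs H], #|e| == 2].
Proof.
case/and3P: (mgraphP H) => /forall_inP hE /forall_inP hA _.
apply/forall_inP => e /setUP[/hE //|/imsetP[a /hA ha ->]].
by rewrite cards2 ha.
Qed.

Definition gr (T : finType) (H : mgraph T) : sgraph T :=
  SGraph (gr_subproof H).

(* Only the values x 0, ..., x n of the sequence x matter. *)
Definition totally_acyclic (T : finType) (H : mgraph T) : Prop :=
  ~ exists (n : nat) (x : nat -> T),
      [/\ 2 <= n, x 0 = x n,
          forall i, i < n ->
            ([set x i; x i.+1] \in medges H) || ((x i, x i.+1) \in marcs H)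
        & exists2 i, i < n & (x i, x i.+1) \in marcs H].

(* Triples (H, c_V, c_E), where c_E is a map on the edges of H.  Since the
   colours in [x] = {1, ..., x} are only compared with each other, [x] is
   represented by 'I_x; the range {0, ..., y} of c_E is 'I_y.+1. *)
Definition opc_triple (T : finType) (x y : nat) : finType :=
  {H : mgraph T &
    ({ffun T -> 'I_x} * {ffun {e | e \in medges H} -> 'I_y.+1})%type}.

Section Triple.

Variables (T : finType) (x y : nat) (t : opc_triple T x y).

Definition opc_graph : mgraph T := tag t.
Definition opc_cV : {ffun T -> 'I_x} := (tagged t).1.
Definition opc_cE : {ffun {e | e \in medges opc_graph} -> 'I_y.+1} :=
  (tagged t).2.

Definition opc_compat : bool :=
  [forall e : {e | e \in medges opc_graph}, forall v, forall w,
    (val e == [set v; w]) ==>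
    ((opc_cE e != 0 :> nat) == (opc_cV v == opc_cV w))].

(* The cardinality of c_E^{-1}([y]). *)
Definition opc_ncoloured : nat := #|[set e | 1 <= opc_cE e <= y]|.

End Triple.

Definition OPC (T : finType) (G : sgraph T) (x y : nat) :
    {set opc_triple T x y} :=
  [set t | [&& gr (opc_graph t) == G,
               `[< totally_acyclic (opc_graph t) >] & opc_compat t]].

(* Main.v *)
Require Import Defs.
Import GRing.Theory Num.Theory.
Local Open Scope ring_scope.

(** Fix the graph H and the colouring c_V.  Summing over c_E, an edge of H
    contributes 1 if its ends have distinct colours, and s k if they have the
    same colour, where k is the number of nonzero values of c_E and s = 1 in the
    first formula, s = -1 in the second.  With z = s k - 1 this is the product
    of the 1 + z [e is monochromatic]; expanding it and summing over c_V (the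
    colourings constant along the edges in F number x^cc(F)) gives
      sum_(F subset of E(H)) z^|F| x^cc(F),
    the Potts form of the Fortuin-Kasteleyn polynomial of gr_0(H).  Exchanging
    the sums over H and F, both formulas reduce to the identity, for every
    F subset of E(G),
      sum_(H) (-1)^cc(gr_0(H)) = (-1)^cc(F),                               (1)
    where H runs over the totally acyclic partial orientations of G whose edges
    include F.

    For (1), encode H by the set M of the ordered pairs (v, w) such that {v, w}
    is an edge or (v, w) is an arc, and use induction on a vertex set U closed
    under F.  Call W terminal in M if no arc starts in W and no pair of M leaves
    W, that is, if W is a union of sink components of H.  Adding or removing one
    sink component changes the sign, so the sum over terminal W of (-1)^cc(W)
    vanishes when U is nonempty ([sum_terminal]).  Isolating the term of the
    empty set writes 1 as minus the sum over the nonempty terminal sets.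
    Multiply (-1)^cc(H) by this expression and exchange the sums: for fixed W,
    the orientations of U in which W is terminal are in bijection with the
    orientations of U \ W, because all edges of G inside W must stay edges and
    all edges of G between U \ W and W must be arcs towards W
    ([sum_terminal_fiber]).  By induction the total is minus the sum of
    (-1)^cc(F on U \ W) over the nonempty F-closed W, and the vanishing of the
    same alternating sum for F itself gives (-1)^cc(F on U)
    ([sum_ta_orient]). *)

Set Implicit Arguments.
Unset Strict Implicit.
Unset Printing Implicit Defensive.

(** * Connected components and alternating sums over closed sets *)

Section Components.

Variable T : finType.
Implicit Types (e f : rel T) (v w : T) (N U W : {set T}).

(** W is stable under following e. *)
Definition is_closed e W := [forall v in W, forall w, e v w ==> (w \in W)].

Lemma is_closedP e W :
  reflect (forall v w, v \in W -> e v w -> w \in W) (is_closed e W).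
Proof.
apply: (iffP forall_inP) => [h v w vW evw|h v vW].
  by have /forallP/(_ w)/implyP/(_ evw) := h v vW.
by apply/forallP => w; apply/implyP; apply: h.
Qed.

Lemma closed_connect_mem e W v w :
  is_closed e W -> v \in W -> connect e v w -> w \in W.
Proof.
move=> /is_closedP cW + /connectP[p + ->].
elim: p v => //= u p IHp v vW /andP[evu ep].
by apply: IHp ep; apply: cW vW evu.
Qed.

Lemma connect_eq_on e e' W :
  is_closed e W -> (forall v w, v \in W -> e v w = e' v w) ->
  forall v, v \in W -> connect e v =1 connect e' v.
Proof.
move=> cW ee' v vW.
have cW' : is_closed e' W.
  by apply/is_closedP => a b aW; rewrite -ee' //; apply: (is_closedP _ _ cW).
have sub (r r' : rel T) : is_closed r W ->
    (forall v w, v \in W -> r v w = r' v w) ->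
    forall w, connect r v w -> connect r' v w.
  move=> cr rr' w /connectP[p + ->]; elim: p v vW => //= u p IHp a aW.
  move=> /andP[rau rp].
  apply: (connect_trans (y := u)); first by rewrite connect1 // -rr'.
  by apply: IHp rp; apply: (is_closedP _ _ cr) rau.
move=> w; apply/idP/idP; first exact: sub.
by apply: sub => // a b aW; rewrite ee'.
Qed.

Lemma n_comp_eq_on e e' W :
  is_closed e W -> (forall v w, v \in W -> e v w = e' v w) ->
  n_comp e W = n_comp e' W.
Proof.
move=> cW ee'; apply: eq_card => v; rewrite !inE /=.
case vW: (v \in W); rewrite ?andbF ?andbT //.
by rewrite /roots /= /fingraph.root (eq_pick (connect_eq_on cW ee' vW)).
Qed.

Lemma n_comp0 e : n_comp e (set0 : {set T}) = 0%N.
Proof. by apply: eq_card0 => v; rewrite !inE andbF. Qed.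

(** [n_comp] counts the canonical roots lying in a set, hence is additive whether
    or not the sets are closed. *)
Lemma n_comp_setD e U W :
  W \subset U -> (n_comp e U = n_comp e W + n_comp e (U :\: W))%N.
Proof.
move=> sWU; rewrite [LHS]/n_comp_mem -(cardID (mem W)); congr (_ + _)%N.
  apply: eq_card => v; rewrite !inE -andbA; congr (_ && _).
  by case vW: (v \in W); rewrite ?andbF // (subsetP sWU).
by apply: eq_card => v; rewrite !inE; case: (v \in W); rewrite ?andbF.
Qed.

Lemma n_comp_sign_setD e U W :
  W \subset U ->
  (-1) ^+ n_comp e U * (-1) ^+ n_comp e W = (-1) ^+ n_comp e (U :\: W) :> int.
Proof.
move=> sWU; rewrite (n_comp_setD e sWU) -exprD addnAC exprD.
by rewrite -signr_odd oddD addbb mul1r.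
Qed.

(** Toggling the component of a fixed vertex of N is an involution that reverses
    the sign. *)
Lemma sum_closed_sign e N :
  symmetric e -> is_closed e N -> N != set0 ->
  \sum_(W : {set T} | (W \subset N) && is_closed e W)
     (-1) ^+ n_comp e W = 0 :> int.
Proof.
move=> es cN /set0Pn[v vN].
have sym_e := sym_connect_sym es.
pose C := [set w | connect e v w].
have cC : is_closed e C.
  by apply/is_closedP => a b; rewrite !inE => va /connect1; apply: connect_trans.
have vC : v \in C by rewrite inE.
have sCN : C \subset N.
  by apply/subsetP => w; rewrite inE; apply: closed_connect_mem.
have nC : n_comp e C = 1%N.
  by rewrite -(n_comp_connect sym_e v); apply: eq_n_comp_r => w; rewrite inE.
(* The closed sets containing v are the W :|: C, for W closed without v. *)
rewrite (bigID (fun W : {set T} => v \in W)) /=.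
rewrite (reindex_onto (fun W => W :|: C) (fun W => W :\: C)); last first.
  move=> W /andP[/andP[_ cW] vW]; apply/setP => w; rewrite !inE.
  case vw: (connect e v w); rewrite ?orbF //= ?orbT.
  by rewrite (closed_connect_mem cW vW vw).
rewrite -[X in _ + X]opprK -sumrN; apply/eqP; rewrite subr_eq0; apply/eqP.
apply: eq_big => [W|W /andP[/andP[/andP[_ _] _] /eqP dW]]; last first.
  have dis: W :&: C = set0 by apply/setP => w; rewrite -dW !inE andbAC andNb.
  rewrite (n_comp_setD e (subsetUr W C)) dW nC add1n exprS mulN1r.
  by [].
rewrite !inE connect0 orbT andbT subUset sCN andbT -!andbA; congr (_ && _).
have sC w u : e w u -> (w \in C) = (u \in C).
  by apply: (intro_closed sym_e) => a b eab aC; apply: (is_closedP _ _ cC) aC eab.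
apply/idP/idP => [/andP[/is_closedP cU /eqP dW]|/andP[/is_closedP cW vW]].
  rewrite -{2}dW !inE connect0 /= andbT; apply/is_closedP => a b.
  rewrite -dW !in_setD => /andP[aC aU] eab.
  by rewrite -(sC _ _ eab) aC (cU _ _ aU eab).
apply/andP; split; last first.
  apply/eqP/setP => w; rewrite in_setD in_setU.
  case wC: (w \in C); rewrite ?orbF //=; apply/esym/negP => wW.
  case/negP: vW; apply: (@closed_connect_mem e W w v) => //; first exact/is_closedP.
  by rewrite sym_e; rewrite inE in wC.
apply/is_closedP => a b; rewrite !in_setU => /orP[aW|aC] eab.
  by rewrite (cW _ _ aW eab).
by rewrite -(sC _ _ eab) aC orbT.
Qed.

End Components.

(** * Totally acyclic mixed relations *)

Section MixedRelations.

Variable T : finType.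
Implicit Types (M : {set T * T}) (v w : T) (N U W : {set T}).

(** A mixed graph is encoded by the set M of pairs (v, w) such that one may step
    from v to w: both (v, w) and (w, v) for an edge, only (v, w) for an arc.
    [mixrel M] is the stepping relation and [symrel M] the edge relation. *)
Definition mixrel M : rel T := [rel v w | (v, w) \in M].

Definition symrel M : rel T := [rel v w | ((v, w) \in M) && ((w, v) \in M)].

Lemma symrelC M : symmetric (symrel M).
Proof. by move=> v w; apply: andbC. Qed.

(** No arc lies on a closed walk: if w leads back to v, a step from v to w is an
    edge. *)
Definition tacyclic M :=
  [forall v, forall w,
     ((v, w) \in M) && connect (mixrel M) w v ==> ((w, v) \in M)].

Lemma tacyclicP M :
  reflect (forall v w, (v, w) \in M -> connect (mixrel M) w v -> (w, v) \in M)
          (tacyclic M).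
Proof.
apply: (iffP forallP) => [h v w vw wv|h v].
  by have /forallP/(_ w)/implyP := h v; apply; rewrite vw.
by apply/forallP => w; apply/implyP => /andP[]; apply: h.
Qed.

(** Every step from a vertex of W stays in W and is along an edge. *)
Definition terminal M W :=
  [forall v in W, forall w, ((v, w) \in M) ==> (w \in W) && ((w, v) \in M)].

Lemma terminalP M W :
  reflect (forall v w, v \in W -> (v, w) \in M -> w \in W /\ (w, v) \in M)
          (terminal M W).
Proof.
apply: (iffP forall_inP) => [h v w vW vw|h v vW].
  by have /forallP/(_ w)/implyP/(_ vw)/andP := h v vW.
by apply/forallP => w; apply/implyP => vw; apply/andP; apply: h.
Qed.

(** The vertices of U from which every walk can be reversed. *)
Definition sinks M U :=
  [set v in U | [forall w, connect (mixrel M) v w ==> connect (mixrel M) w v]].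

Lemma sinksP M U v :
  reflect (v \in U /\ forall w, connect (mixrel M) v w -> connect (mixrel M) w v)
          (v \in sinks M U).
Proof.
rewrite inE; apply: (iffP andP) => -[vU h]; split=> //.
  by move=> w; move/forallP/(_ w)/implyP: h.
by apply/forallP => w; apply/implyP; apply: h.
Qed.

Lemma sinks_neq0 M U : is_closed (mixrel M) U -> U != set0 -> sinks M U != set0.
Proof.
move=> cU /set0Pn[v0 v0U].
(* A vertex reaching the fewest vertices is in a sink component. *)
have [v vU vmin] :=
  @arg_minnP T v0 (mem U) (fun v => #|connect (mixrel M) v|) v0U.
apply/set0Pn; exists v; apply/sinksP; split=> // w vw.
have wU: w \in U by apply: closed_connect_mem vw.
have sub: connect (mixrel M) w \subset connect (mixrel M) v.
  by apply/subsetP => u; apply: connect_trans vw.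
have := vmin w wU; rewrite (geq_leqif (subset_leqif_card sub)).
by move=> /subsetP/(_ v); apply; apply: connect0.
Qed.

(** In a totally acyclic M, terminal sets are the unions of sink components. *)
Lemma terminal_sinks M U W :
  tacyclic M ->
  (W \subset U) && terminal M W =
  (W \subset sinks M U) && is_closed (symrel M) W.
Proof.
move=> /tacyclicP tM; apply/andP/andP => -[sW]; last first.
  move=> /is_closedP cW; split.
    by apply: subset_trans sW _; apply/subsetP => v /sinksP[].
  apply/terminalP => v w vW vw.
  have wv : (w, v) \in M.
    by apply: (tM _ _ vw); have /sinksP[_] := subsetP sW v vW; apply; apply: connect1.
  by split=> //; apply: (cW v) => //; apply/andP.
move=> /terminalP tW; split; last first.
  by apply/is_closedP => v w vW /andP[vw _]; case: (tW _ _ vW vw).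
apply/subsetP => v vW; apply/sinksP; split; first exact: (subsetP sW).
move=> w /connectP[p + ->]; elim: p v vW => //= u p IHp v vW /andP[vu up].
have [uW uv] := tW _ _ vW vu.
by apply: connect_trans (IHp u uW up) _; apply: connect1.
Qed.

Lemma sum_terminal M U :
  tacyclic M -> is_closed (mixrel M) U -> U != set0 ->
  \sum_(W : {set T} | (W \subset U) && terminal M W)
     (-1) ^+ n_comp (symrel M) W = 0 :> int.
Proof.
move=> tM cU nU; rewrite (eq_bigl _ _ (fun W => terminal_sinks U W tM)).
apply: sum_closed_sign; [exact: symrelC| |exact: sinks_neq0].
apply/is_closedP => v w /sinksP[vU vs] /andP[vw wv]; apply/sinksP.
split; first exact: (is_closedP _ _ cU) vU vw.
move=> u wu; apply: connect_trans (connect1 vw).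
by apply: vs; apply: connect_trans wu; apply: connect1.
Qed.

(** * The signed count of totally acyclic partial orientations *)

Section Orientations.

Variables g f : rel T.
Hypotheses (gC : symmetric g) (fC : symmetric f) (sfg : subrel f g).

(** M is a partial orientation of the subgraph of g induced on U. *)
Definition orients U M :=
  [forall v, forall w,
     ((v, w) \in M) || ((w, v) \in M) == [&& v \in U, w \in U & g v w]].

Lemma orientsP U M :
  reflect (forall v w,
     ((v, w) \in M) || ((w, v) \in M) = [&& v \in U, w \in U & g v w])
    (orients U M).
Proof.
apply: (iffP forallP) => [h v w|h v]; first by have /forallP/(_ w)/eqP := h v.
by apply/forallP => w; apply/eqP.
Qed.

(** The edges of f inside U are in M; as f is symmetric, they are edges of M and
    not arcs. *)
Definition contains_on U M :=
  [forall v in U, forall w in U, f v w ==> ((v, w) \in M)].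

Lemma contains_onP U M :
  reflect (forall v w, v \in U -> w \in U -> f v w -> (v, w) \in M)
          (contains_on U M).
Proof.
apply: (iffP forall_inP) => [h v w vU wU vw|h v vU].
  by have /forall_inP/(_ w wU)/implyP := h v vU; apply.
by apply/forall_inP => w wU; apply/implyP; apply: h.
Qed.

(** The totally acyclic partial orientations of g on U in which the edges of f
    remain unoriented. *)
Definition ta_orient U M := [&& orients U M, tacyclic M & contains_on U M].

(** Extends an orientation of U :\: W to U by making W terminal: all edges of g
    inside W are left unoriented, and those between U :\: W and W point to W. *)
Definition extend U W M :=
  M :|: [set a : T * T | [&& a.1 \in U, a.2 \in W & g a.1 a.2]].

Definition restrict U W M :=
  M :&: [set a : T * T | (a.1 \in U :\: W) && (a.2 \in U :\: W)].

Lemma orients_mem U M v w :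
  orients U M -> (v, w) \in M -> [/\ v \in U, w \in U & g v w].
Proof. by move=> /orientsP h vw; apply/and3P; rewrite -h vw. Qed.

Lemma restrictK U W M :
  W \subset U -> orients U M -> terminal M W -> extend U W (restrict U W M) = M.
Proof.
move=> sWU oM /terminalP tW; apply/setP => -[v w]; rewrite !inE /=.
apply/idP/idP => [/orP[/andP[]//|/and3P[vU wW gvw]]|vw].
  have /orP[//|wv] : ((v, w) \in M) || ((w, v) \in M).
    by rewrite (orientsP _ _ oM) vU gvw (subsetP sWU).
  by have [] := tW _ _ wW wv.
have [vU wU gvw] := orients_mem oM vw.
rewrite vw vU wU gvw; case wW: (w \in W); rewrite ?orbT //= orbF andbT.
by rewrite andbT; apply/negP => vW; have [] := tW _ _ vW vw; rewrite wW.
Qed.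

Lemma extendK U W M :
  orients (U :\: W) M -> restrict U W (extend U W M) = M.
Proof.
move=> oM; apply/setP => -[v w]; rewrite !inE /=.
apply/idP/idP => [/andP[/orP[//|/and3P[_ -> _]]]|vw]; first by rewrite andbF.
by have [] := orients_mem oM vw; rewrite !inE vw => -> ->.
Qed.

Lemma terminal_closed U W M :
  W \subset U -> is_closed f U -> contains_on U M -> terminal M W ->
  is_closed f W.
Proof.
move=> sWU /is_closedP cU /contains_onP cM /terminalP tW.
apply/is_closedP => v w vW vw; have vU := subsetP sWU _ vW.
by have [] := tW v w vW (cM v w vU (cU v w vU vw) vw).
Qed.

Lemma ta_restrict U W M :
  ta_orient U M -> ta_orient (U :\: W) (restrict U W M).
Proof.
move=> /and3P[oM tM cM]; apply/and3P; split.
- apply/orientsP => v w; rewrite !inE /=.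
  have := orientsP _ _ oM v w.
  case: (v \in W); case: (w \in W); case: (v \in U); case: (w \in U);
    by rewrite /= ?andbF ?andbT ?orbF.
- apply/tacyclicP => v w; rewrite !inE /= => /andP[vw /andP[-> ->]] wv.
  rewrite /= andbT; apply: (tacyclicP _ tM _ _ vw).
  by apply: connect_sub wv => a b /setIP[ab _]; apply: connect1.
- apply/contains_onP => v w vU wU vw; rewrite !inE /= -!in_setD vU wU !andbT.
  move: vU wU; rewrite !inE => /andP[_ vU] /andP[_ wU].
  exact: (contains_onP _ _ cM).
Qed.

Lemma terminal_extend U W M :
  W \subset U -> orients (U :\: W) M -> terminal (extend U W M) W.
Proof.
move=> sWU oM; apply/terminalP => v w vW; rewrite !inE /= vW.
move=> /orP[vw|/and3P[vU wW gvw]].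
  by have [] := orients_mem oM vw; rewrite inE vW.
by rewrite wW gC gvw (subsetP sWU _ wW) orbT.
Qed.

Lemma ta_extend U W M :
  W \subset U -> is_closed f W -> ta_orient (U :\: W) M ->
  ta_orient U (extend U W M).
Proof.
move=> sWU /is_closedP cW /and3P[oM tM cM]; apply/and3P; split.
- apply/orientsP => v w; rewrite !inE /= orbACA (orientsP _ _ oM) !inE.
  rewrite (gC w v); case vW: (v \in W); case wW: (w \in W);
    rewrite /= ?andbF ?orbF ?(subsetP sWU _ vW) ?(subsetP sWU _ wW) //=;
    by rewrite ?orbb ?andbT.
- have/terminalP tW := terminal_extend sWU oM.
  apply/tacyclicP => v w vw wv.
  (* A closed walk of the extension meeting W stays in W, where all is
     unoriented; otherwise it is a closed walk of M. *)
  have [wW|wW] := boolP (w \in W).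
    have vW : v \in W.
      apply: (@closed_connect_mem T (mixrel (extend U W M)) W w) => //.
      by apply/is_closedP => a b aW ab; case: (tW _ _ aW ab).
    by case: (tW _ _ vW vw).
  have notW a b : (a, b) \in extend U W M -> b \notin W -> (a, b) \in M.
    by rewrite !inE /= => /orP[//|/and3P[_ ->]].
  have vW : v \notin W.
    by apply: contra wW => vW; case: (tW _ _ vW vw).
  rewrite inE (tacyclicP _ tM) //; first exact: notW.
  case/connectP: wv => p wp ev; rewrite {}ev {v vw} in vW *.
  elim: p w wp vW {wW} => //= u p IHp w /andP[wu up] vW.
  apply: connect_trans (IHp u up vW); apply: connect1; apply: (notW) => //.
  apply: contra vW => uW.
  apply: (@closed_connect_mem T (mixrel (extend U W M)) W u) => //.
    by apply/is_closedP => a b aW ab; case: (tW _ _ aW ab).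
  by apply/connectP; exists p.
- apply/contains_onP => v w vU wU vw; rewrite !inE /= vU (sfg vw) andbT.
  have [wW|wW] := boolP (w \in W); first by rewrite orbT.
  rewrite (contains_onP _ _ cM) // inE ?wW // vU andbT.
  by apply: contra wW => vW; apply: cW vw.
Qed.

(** [extend U W] and [restrict U W] are inverse bijections, and they preserve the
    components outside of W. *)
Lemma sum_terminal_fiber U W :
  W \subset U -> is_closed f W ->
  \sum_(M | ta_orient U M && terminal M W)
     (-1) ^+ n_comp (symrel M) (U :\: W) =
  \sum_(M | ta_orient (U :\: W) M)
     (-1) ^+ n_comp (symrel M) (U :\: W) :> int.
Proof.
move=> sWU cW.
rewrite (reindex_onto (extend U W) (restrict U W)) /=; last first.
  by move=> M /andP[/and3P[oM _ _]]; apply: restrictK.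
apply: eq_big => [M|M /andP[/andP[taM tW] /eqP eM]].
  apply/andP/idP => [[/andP[taM _] /eqP <-]|taM]; first exact: ta_restrict.
  have oM : orients (U :\: W) M by case/and3P: taM.
  by rewrite extendK // ta_extend // terminal_extend.
(* No edge joins W to U :\: W, so the components in U :\: W are those of M. *)
congr (_ ^+ _); apply: n_comp_eq_on => [|v w].
  apply/is_closedP => v w; rewrite !in_setD => /andP[vW vU] /= /andP[vw wv].
  case/and3P: taM => oM _ _.
  have [_ -> _] := orients_mem oM vw; rewrite andbT.
  by apply: contra vW => wW; have [] := terminalP _ _ tW _ _ wW wv.
rewrite /symrel /= !inE /= => /andP[/negbTE vW vU]; rewrite vW /= !andbF orbF.
have [wW|_] := boolP (w \in W); last by rewrite /= !andbF !orbF.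
have /negbTE-> : (w, v) \notin M by rewrite -eM !inE /= wW /= !andbF.
by rewrite !andbF.
Qed.

Lemma sum_ta_orient U :
  is_closed f U ->
  \sum_(M | ta_orient U M) (-1) ^+ n_comp (symrel M) U
  = (-1) ^+ n_comp f U :> int.
Proof.
have [n] := ubnP #|U|; elim: n U => // n IHn U; rewrite ltnS => leUn cU.
have [->|nU] := eqVneq U set0.
  rewrite (big_pred1 (set0 : {set T * T})) ?n_comp0 //= => M.
  apply/idP/eqP => [/and3P[oM _ _]|->]; last first.
    apply/and3P; split.
    - by apply/orientsP => v w; rewrite !inE.
    - by apply/tacyclicP => v w; rewrite inE.
    - by apply/contains_onP => v w; rewrite inE.
  apply/setP => -[v w]; rewrite inE; apply/negP => vw.
  by have [] := orients_mem oM vw; rewrite inE.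
(* Replace 1 by minus the sum over the nonempty terminal sets. *)
pose Q M W := (W \subset U) && terminal M W.
pose P W := (W \subset U) && is_closed f W.
transitivity (\sum_(M | ta_orient U M) \sum_(W | Q M W && (W != set0))
   - (-1) ^+ n_comp (symrel M) (U :\: W) : int).
  apply: eq_bigr => M /and3P[oM tM cM].
  have cUM : is_closed (mixrel M) U.
    by apply/is_closedP => v w vU vw; have [] := orients_mem oM vw.
  have := sum_terminal tM cUM nU; rewrite (bigD1 set0) /=; last first.
    by rewrite sub0set; apply/terminalP => v w; rewrite inE.
  rewrite n_comp0 expr0 => /eqP; rewrite addr_eq0 => /eqP one.
  rewrite -[LHS]mulr1 [X in _ * X]one mulrN mulr_sumr -sumrN.
  apply: eq_bigr => W /andP[/andP[sWU _] _]; congr (- _).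
  by rewrite n_comp_sign_setD.
(* For a fixed W, count the orientations in which W is terminal. *)
rewrite (exchange_big_dep (fun W => P W && (W != set0))) /=; last first.
  move=> M W /and3P[oM tM cM] /andP[/andP[sWU tW] ->]; rewrite /P sWU andbT /=.
  exact: terminal_closed cM tW.
transitivity (\sum_(W | P W && (W != set0)) - (-1) ^+ n_comp f (U :\: W) : int).
  apply: eq_bigr => W /andP[/andP[sWU cW] nW]; rewrite sumrN; congr (- _).
  rewrite -IHn.
  - rewrite -sum_terminal_fiber //; apply: eq_bigl => M.
    by rewrite /Q sWU nW andbT.
  - apply: leq_trans leUn; rewrite -(cardsID W U) -[ltnLHS]add0n ltn_add2r.
    by rewrite (setIidPr sWU) card_gt0.
  - apply/is_closedP => v w; rewrite !in_setD => /andP[vW vU] vw.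
    rewrite (is_closedP _ _ cU _ _ vU vw) andbT; apply: contra vW => wW.
    by apply: (is_closedP _ _ cW _ _ wW); rewrite fC.
(* The same alternating sum, now for the components of f. *)
have := sum_closed_sign fC cU nU; rewrite (bigD1 set0) /=; last first.
  by rewrite sub0set; apply/is_closedP => v w; rewrite inE.
rewrite n_comp0 expr0 => /eqP; rewrite addr_eq0 => /eqP one.
rewrite -[RHS]mulr1 [X in _ * X]one mulrN mulr_sumr -sumrN.
apply: eq_bigr => W /andP[/andP[sWU _] _]; congr (- _).
by rewrite n_comp_sign_setD.
Qed.

End Orientations.

End MixedRelations.

(** * Mixed graphs as mixed relations *)

Section PartialOrientations.

Variable T : finType.
Implicit Types (H : mgraph T) (M : {set T * T}) (v w : T).

(** Adjacency along the edges in F; [cc F] counts its components. *)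
Definition edge_rel (F : {set {set T}}) : rel T := [rel v w | [set v; w] \in F].

Lemma edge_relC F : symmetric (edge_rel F).
Proof. by move=> v w; rewrite /edge_rel /= setUC. Qed.

Lemma eq_edge_sets (E E' : {set {set T}}) :
  {in E, forall e : {set T}, #|e| == 2} -> {in E', forall e : {set T}, #|e| == 2} ->
  (forall v w, ([set v; w] \in E) = ([set v; w] \in E')) -> E = E'.
Proof.
move=> h h' eE; apply/setP => e; apply/idP/idP => eE0.
  by have /cards2P[v [w [_ ew]]] := h _ eE0; rewrite ew -eE -ew.
by have /cards2P[v [w [_ ew]]] := h' _ eE0; rewrite ew eE -ew.
Qed.

Lemma sub_edge_sets (E E' : {set {set T}}) :
  {in E, forall e : {set T}, #|e| == 2} ->
  (forall v w, [set v; w] \in E -> [set v; w] \in E') -> E \subset E'.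
Proof.
move=> h eE; apply/subsetP => e eE0.
by have /cards2P[v [w [_ ew]]] := h _ eE0; rewrite ew; apply: eE; rewrite -ew.
Qed.

Lemma sgraph_card2 (G : sgraph T) : {in edges G, forall e : {set T}, #|e| == 2}.
Proof. by case: G => E /= /forall_inP. Qed.

Lemma medge_card2 H : {in medges H, forall e : {set T}, #|e| == 2}.
Proof. exact: (@sgraph_card2 (gr0 H)). Qed.

Lemma medge_neq H v w : [set v; w] \in medges H -> v != w.
Proof. by move/medge_card2; rewrite cards2; case: (v != w). Qed.

Lemma marc_neq H v w : (v, w) \in marcs H -> v != w.
Proof. by case/and3P: (mgraphP H) => _ /forall_inP h _; apply: (h (v, w)). Qed.

Lemma marc_notin_medges H v w :
  (v, w) \in marcs H -> [set v; w] \notin medges H.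
Proof.
move=> vw; case/and3P: (mgraphP H) => _ _ /forallP/(_ v)/forallP/(_ w).
rewrite (marc_neq vw) /=; rewrite -/(medges H) -/(marcs H) vw.
by case: (_ \in medges H).
Qed.

Lemma marc_asym H v w : (v, w) \in marcs H -> (w, v) \notin marcs H.
Proof.
move=> vw; case/and3P: (mgraphP H) => _ _ /forallP/(_ v)/forallP/(_ w).
rewrite (marc_neq vw) /=; rewrite -/(medges H) -/(marcs H) vw.
by case: (_ \in medges H); case: (_ \in marcs H).
Qed.

(** The steps along the edges and the arcs of H. *)
Definition rel_of_mgraph H : {set T * T} :=
  [set a | ([set a.1; a.2] \in medges H) || (a \in marcs H)].

Lemma symrel_mgraph H : symrel (rel_of_mgraph H) =2 edge_rel (medges H).
Proof.
move=> v w; rewrite /symrel /edge_rel /= !inE /= [[set w; v]]setUC.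
case: (_ \in medges H) => //=; apply/negP => /andP[vw wv].
by have := marc_asym vw; rewrite wv.
Qed.

Lemma mem_gr H v w :
  ([set v; w] \in edges (gr H)) =
  ((v, w) \in rel_of_mgraph H) || ((w, v) \in rel_of_mgraph H).
Proof.
rewrite !inE /= [[set w; v]]setUC; case vw: (_ \in medges H) => //=.
apply/imsetP/orP => [[[a b] ab /= e]|].
  have hv : v \in [set a; b] by rewrite -e set21.
  have hw : w \in [set a; b] by rewrite -e set22.
  have nab := marc_neq ab.
  have nvw : v != w by have := cards2 v w; rewrite e cards2 nab; case: (v != w).
  by case/set2P: hv nvw => ->; case/set2P: hw => ->;
     rewrite ?eqxx // => _; [left|right].
by case=> h; [exists (v, w)|exists (w, v)] => //=; rewrite setUC.
Qed.

Fact mgraph_of_rel_subproof M :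
  mixed_axiom [set e : {set T} | (#|e| == 2) &&
                 [forall v in e, forall w in e, (v != w) ==> ((v, w) \in M)]]
              [set a | [&& a.1 != a.2, a \in M & (a.2, a.1) \notin M]].
Proof.
apply/and3P; split; [apply/forall_inP => e|apply/forall_inP => e|].
- by rewrite inE => /andP[].
- by rewrite inE => /andP[].
apply/forallP => v; apply/forallP => w; apply/implyP => nvw.
rewrite !inE /= [w == v]eq_sym nvw /=.
case vwE: [forall a in _, _]; last by rewrite andbF; do 2!case: (_ \in M).
have /forall_inP/(_ v (set21 _ _))/forall_inP/(_ w (set22 _ _)) := vwE.
have /forall_inP/(_ w (set22 _ _))/forall_inP/(_ v (set21 _ _)) := vwE.
by rewrite [w == v]eq_sym nvw /= => -> ->; case: (_ == _).
Qed.

(** The mixed graph of a mixed relation; loops of M are discarded, so that no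
    condition on M is needed. *)
Definition mgraph_of_rel M : mgraph T :=
  @MGraph T (_, _) (mgraph_of_rel_subproof M).

Lemma mem_medges_of_rel M v w :
  ([set v; w] \in medges (mgraph_of_rel M)) = (v != w) && symrel M v w.
Proof.
rewrite inE cards2; case: (eqVneq v w) => //= nvw.
apply/forall_inP/andP => [h|[vw wv] a].
  have /forall_inP/(_ w (set22 _ _)) := h v (set21 _ _).
  have /forall_inP/(_ v (set21 _ _)) := h w (set22 _ _).
  by rewrite [w == v]eq_sym nvw /= => -> ->.
by move=> /set2P[]->; apply/forall_inP => b /set2P[]->; rewrite ?eqxx ?vw ?wv ?implybT.
Qed.

Lemma mgraph_of_relK M :
  (forall v, (v, v) \notin M) -> rel_of_mgraph (mgraph_of_rel M) = M.
Proof.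
move=> irrM; apply/setP => -[v w]; rewrite inE mem_medges_of_rel inE /= /symrel /=.
case: (eqVneq v w) => [<-|_] /=; first by rewrite (negbTE (irrM v)).
by case: (_ \in M); case: (_ \in M).
Qed.

Lemma rel_of_mgraphK H : mgraph_of_rel (rel_of_mgraph H) = H.
Proof.
apply: val_inj; rewrite [RHS]surjective_pairing; congr (_, _).
  apply: (@eq_edge_sets (medges (mgraph_of_rel _)) (medges H)).
  - exact: medge_card2.
  - exact: medge_card2.
  move=> v w; rewrite mem_medges_of_rel symrel_mgraph /edge_rel /=.
  by case vw: (_ \in medges H); rewrite ?andbF // (medge_neq vw).
apply/setP => -[v w]; rewrite -/(marcs H) !inE /= [[set w; v]]setUC.
apply/and3P/idP => [[_ /orP[->//|//]]|vw].
rewrite (marc_neq vw) vw orbT (negbTE (marc_notin_medges vw)).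
by rewrite (negbTE (marc_asym vw)).
Qed.

Lemma totally_acyclicP H :
  reflect (totally_acyclic H) (tacyclic (rel_of_mgraph H)).
Proof.
set M := rel_of_mgraph H.
apply: (iffP (tacyclicP _)) => [tM [n [x [_ x0n xM [i lt_in xi]]]]|tH v w vw wv].
  (* After an arc x_i x_(i+1), the rest of the closed walk leads back to x_i. *)
  have con a b : (a <= b)%N -> (b <= n)%N -> connect (mixrel M) (x a) (x b).
    elim: b => [|b IHb]; first by rewrite leqn0 => /eqP->.
    rewrite leq_eqVlt ltnS => /orP[/eqP->//|leab] ltbn.
    apply: connect_trans (IHb leab (ltnW ltbn)) (connect1 _).
    by rewrite /mixrel /= inE /= xM.
  have vw : (x i, x i.+1) \in M by rewrite inE /= xi orbT.
  have : (x i.+1, x i) \in M.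
    apply: (tM _ _ vw); apply: connect_trans (con i.+1 n _ _) _ => //.
    by rewrite -x0n con // ltnW.
  rewrite inE /= setUC (negbTE (marc_notin_medges xi)) /=.
  by rewrite (negbTE (marc_asym xi)).
have := vw; rewrite !inE /= => /orP[|vwA]; first by rewrite setUC => ->.
case/connectP: wv => p wp ev; case: tH.
(* The closed walk v, w, then p back to v; it has at least two steps. *)
exists (size p).+1, (fun i => nth v (v :: w :: p) i); split.
- by case: p wp ev => // _ ev; have := marc_neq vwA; rewrite ev eqxx.
- by rewrite /= -[size p]/(size (w :: p)).-1 nth_last.
- case=> [_|i lt_ip] /=; first by rewrite vwA orbT.
  by have /(pathP v)/(_ i lt_ip) := wp; rewrite /mixrel /= inE.
- by exists 0%N.
Qed.

Variables (G : sgraph T) (F : {set {set T}}).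
Hypothesis sFG : F \subset edges G.

Lemma ta_orient_mgraph H :
  ta_orient (edge_rel G) (edge_rel F) setT (rel_of_mgraph H) =
  [&& gr H == G, tacyclic (rel_of_mgraph H) & F \subset medges H].
Proof.
congr [&& _, _ & _].
  apply/orientsP/eqP => [oH|<- v w]; last by rewrite !inE /edge_rel /= mem_gr !inE.
  apply: val_inj; apply: eq_edge_sets; try exact: sgraph_card2.
  by move=> v w; rewrite mem_gr oH !inE.
have F2 : {in F, forall e : {set T}, #|e| == 2}.
  by move=> e /(subsetP sFG); apply: sgraph_card2.
apply/contains_onP/idP => [cF|/subsetP sF v w _ _ vw]; last first.
  by rewrite inE /= sF.
apply: (sub_edge_sets F2) => v w vw.
have := symrel_mgraph H v w; rewrite /edge_rel /= => <-.
by apply/andP; split; apply: cF; rewrite ?inE // /edge_rel /= setUC.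
Qed.

(** Identity (1). *)
Lemma sum_partial_orientations :
  \sum_(H | [&& gr H == G, tacyclic (rel_of_mgraph H) & F \subset medges H])
     (-1) ^+ cc (gr0 H) = (-1) ^+ cc F :> int.
Proof.
rewrite (reindex_onto mgraph_of_rel rel_of_mgraph) /=; last first.
  by move=> H _; apply: rel_of_mgraphK.
have ccE (e : rel T) : n_comp e T = n_comp e [set: T].
  by apply: eq_n_comp_r => v; rewrite !inE.
rewrite [in RHS]/cc ccE -/(edge_rel F).
rewrite -(@sum_ta_orient T (edge_rel G) (edge_rel F)); first last.
- by apply/is_closedP => v w _ _; rewrite inE.
- by move=> v w; apply: (subsetP sFG).
- exact: edge_relC.
- exact: edge_relC.
apply: eq_big => [M|M /andP[_ /eqP eM]].
  rewrite -ta_orient_mgraph; apply/andP/idP => [[+ /eqP eM]|taM].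
    by rewrite eM.
  suff -> : rel_of_mgraph (mgraph_of_rel M) = M by [].
  apply: mgraph_of_relK => v; apply/negP => vv.
  have /and3P[oM _ _] := taM.
  have [_ _] := orients_mem oM vv; rewrite /edge_rel /= => /sgraph_card2.
  by rewrite cards2 eqxx.
congr (_ ^+ _); rewrite /cc ccE; apply: eq_n_comp; apply: eq_connect => v w.
by rewrite -{2}eM symrel_mgraph.
Qed.

End PartialOrientations.

(** * Colourings and the Potts expansion *)

Section Colourings.

Variable T : finType.
Implicit Types (E F : {set {set T}}) (G : sgraph T) (H : mgraph T).

Lemma card_constant_maps (K : finType) (e : rel T) :
  symmetric e ->
  #|[set c : {ffun T -> K} | [forall v, forall w, e v w ==> (c v == c w)]]|
  = (#|K| ^ n_comp e T)%N.
Proof.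
move=> es; have sym_e := sym_connect_sym es.
have rT v : fingraph.root e v \in roots e by apply: roots_root.
pose R := {v | v \in roots e}.
pose h (d : {ffun R -> K}) : {ffun T -> K} :=
  [ffun v => d (Sub (fingraph.root e v) (rT v))].
have inj_h : injective h.
  move=> d d' /ffunP hd; apply/ffunP => r; have := hd (val r); rewrite !ffunE.
  suff -> : Sub (fingraph.root e (val r)) (rT (val r)) = r by [].
  by apply: val_inj => /=; apply/eqP; apply: (valP r).
have -> : n_comp e T = #|{: R}|.
  by rewrite card_sig; apply: eq_card => v; rewrite !inE andbT.
rewrite -card_ffun -cardsT -(card_imset _ inj_h); apply: eq_card => c.
rewrite inE; apply/idP/imsetP => [/forallP hc|[d _ ->]].
  have cc v w : connect e v w -> c v = c w.
    case/connectP=> p + ->; elim: p v => //= u p IHp v /andP[vu up].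
    by rewrite -(IHp _ up); have /forallP/(_ u)/implyP/(_ vu)/eqP := hc v.
  exists [ffun r : R => c (val r)]; rewrite ?inE //.
  by apply/ffunP => v; rewrite !ffunE /=; apply/cc/connect_root.
apply/forallP => v; apply/forallP => w; apply/implyP => vw; apply/eqP.
rewrite !ffunE; congr (d _); apply: val_inj => /=.
by apply/eqP; rewrite root_connect // connect1.
Qed.

(** The edge e is monochromatic for c. *)
Definition mono (x : nat) (c : {ffun T -> 'I_x}) (e : {set T}) :=
  [forall v in e, forall w in e, c v == c w].

Lemma mono2 x (c : {ffun T -> 'I_x}) v w : mono c [set v; w] = (c v == c w).
Proof.
apply/forall_inP/eqP => [h|vw u].
  by have /forall_inP/(_ w (set22 _ _))/eqP := h v (set21 _ _).
by case/set2P => ->; apply/forall_inP => a /set2P[]->; rewrite ?vw.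
Qed.

Lemma card_mono_colourings x F :
  {in F, forall e : {set T}, #|e| == 2} ->
  #|[set c : {ffun T -> 'I_x} | [forall e in F, mono c e]]| = (x ^ cc F)%N.
Proof.
move=> F2; rewrite -[X in (X ^ _)%N]card_ord.
rewrite -(card_constant_maps _ (@edge_relC T F)); apply: eq_card => c; rewrite !inE.
apply/forall_inP/forallP => [h v|h e eF].
  by apply/forallP => w; apply/implyP => /h; rewrite mono2.
have /cards2P[v [w [_ evw]]] := F2 e eF; rewrite evw mono2.
by have /forallP/(_ w)/implyP := h v; apply; rewrite /edge_rel /= -evw.
Qed.

Lemma prod_1D (I : finType) (A : {set I}) (a : I -> int) :
  \prod_(i in A) (1 + a i) = \sum_(B : {set I} | B \subset A) \prod_(i in B) a i.
Proof.
rewrite big_mkcond /= (eq_bigr (fun i => (if i \in A then a i else 0) + 1)).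
  rewrite bigA_distr [RHS]big_mkcond; apply: eq_bigr => B _ /=.
  case: ifPn => [/subsetP sBA|/subsetPn[i iB iA]].
    by rewrite [RHS]big_mkcond; apply: eq_bigr => i _; case: ifP => // /sBA ->.
  by rewrite (bigD1 i) //= iB (negbTE iA) mul0r.
by move=> i _; case: ifP; rewrite ?add0r // addrC.
Qed.

Lemma prod_nat_bool (I : finType) (A : {set I}) (b : pred I) :
  \prod_(i in A) (b i)%:R = [forall i in A, b i]%:R :> int.
Proof.
case: (boolP [forall i in A, b i]) => [/forall_inP h|/forall_inPn[i iA /negbTE bi]].
  by apply: big1 => i /h ->.
by rewrite (bigD1 i) //= bi mul0r.
Qed.

Lemma potts_expansion x (y : int) E :
  {in E, forall e : {set T}, #|e| == 2} ->
  \sum_(c : {ffun T -> 'I_x}) \prod_(e in E) (1 + y * (mono c e)%:R)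
  = \sum_(F : {set {set T}} | F \subset E) y ^+ #|F| * x%:R ^+ cc F.
Proof.
move=> E2; under eq_bigr do rewrite prod_1D.
rewrite exchange_big /=; apply: eq_bigr => F /subsetP sFE.
under eq_bigr do rewrite big_split prodr_const prod_nat_bool /=.
rewrite -mulr_sumr -natrX -card_mono_colourings => [|e /sFE]; last exact: E2.
rewrite -sum1_card natr_sum [in RHS]big_mkcond; congr (_ * _).
by apply: eq_bigr => c _; rewrite inE; case: [forall e in F, _].
Qed.

(** The triple (H, c_V, c_E). *)
Definition triple x k H (cV : {ffun T -> 'I_x})
    (cE : {ffun {e | e \in medges H} -> 'I_k.+1}) : opc_triple T x k :=
  existT _ H (cV, cE).

Lemma compat_tripleE x k H (cV : {ffun T -> 'I_x})
    (cE : {ffun {e | e \in medges H} -> 'I_k.+1}) :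
  opc_compat (triple cV cE) =
  [forall e, (cE e != 0 :> nat) == mono cV (val e)].
Proof.
apply/forallP/forallP => h e; last first.
  apply/forallP => v; apply/forallP => w; apply/implyP => /eqP evw.
  by have := h e; rewrite evw mono2.
have /cards2P[v [w [_ evw]]] := medge_card2 (valP e).
have /forallP/(_ v)/forallP/(_ w) := h e.
by rewrite evw eqxx mono2.
Qed.

(** The edge colourings are chosen independently on the edges: a monochromatic
    edge takes one of k nonzero values, each of weight s, and any other edge
    takes the value 0. *)
Lemma sum_edge_colourings x k H (cV : {ffun T -> 'I_x}) (s : int) :
  \sum_(cE : {ffun {e | e \in medges H} -> 'I_k.+1} | opc_compat (triple cV cE))
     s ^+ opc_ncoloured (triple cV cE)
  = \prod_(e in medges H) (1 + (s *+ k - 1) * (mono cV e)%:R).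
Proof.
pose wt e (j : 'I_k.+1) : int :=
  if (j != 0 :> nat) == mono cV e then s ^+ (j != 0 :> nat) else 0.
transitivity (\prod_(e in medges H) \sum_j wt e j); last first.
  apply: eq_bigr => e _; rewrite big_ord_recl /wt /=.
  case: (mono cV e) => /=; last by rewrite mulr0 big1.
  by rewrite mulr1 [RHS]addrC subrK add0r sumr_const card_ord expr1.
rewrite [RHS]big_sub bigA_distr_bigA big_mkcond; apply: eq_bigr => cE _.
rewrite compat_tripleE /=.
case: forallP => [h|/forallP/forallPn[e /negbTE he]]; last first.
  by rewrite (bigD1 e) //= /wt he mul0r.
rewrite (eq_bigr (fun e => s ^+ (cE e != 0 :> nat))) => [|e _]; last first.
  by rewrite /wt (h e).
rewrite prodrXr; congr (_ ^+ _).
rewrite /opc_ncoloured -sum1_card big_mkcond; apply: eq_bigr => e _.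
rewrite inE /opc_cE /= lt0n -(ltnS (cE e) k) ltn_ord andbT.
by case: (_ != _).
Qed.

Lemma fk_poly_eval G (x y : int) :
  (fk_poly G).[x, y] =
  \sum_(F : {set {set T}} | F \subset G) x ^+ cc F * y ^+ #|F|.
Proof.
rewrite /fk_poly !horner_sum; apply: eq_bigr => F _.
by rewrite !hornerE.
Qed.

(** The two formulas of the theorem in one: s = 1 and s = -1. *)
Lemma sum_OPC G x k (s : int) :
  \sum_(t in OPC G x k) (-1) ^+ cc (gr0 (opc_graph t)) * s ^+ opc_ncoloured t
  = (fk_poly G).[- x%:Z, s *+ k - 1].
Proof.
pose O H := (gr H == G) && tacyclic (rel_of_mgraph H).
transitivity (\sum_(H | O H) (-1) ^+ cc (gr0 H) *
   \sum_(F : {set {set T}} | F \subset medges H)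
      (s *+ k - 1) ^+ #|F| * x%:R ^+ cc F : int).
  transitivity (\sum_(H | O H)
     \sum_(c : {ffun T -> 'I_x} * {ffun {e | e \in medges H} -> 'I_k.+1} |
              opc_compat (triple c.1 c.2))
        (-1) ^+ cc (gr0 H) * s ^+ opc_ncoloured (triple c.1 c.2)).
    rewrite sig_big_dep /=; apply: eq_big => [[H [cV cE]]|[H [cV cE]] _] //=.
    rewrite inE /O -andbA; congr [&& _, _ & _].
    by apply/asboolP/idP => /totally_acyclicP.
  apply: eq_bigr => H _; rewrite -mulr_sumr; congr (_ * _).
  rewrite -(pair_big_dep predT (fun cV cE => opc_compat (triple cV cE))
              (fun cV cE => s ^+ opc_ncoloured (triple cV cE))) /=.
  rewrite -potts_expansion; last exact: medge_card2.
  by apply: eq_bigr => cV _; apply: sum_edge_colourings.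
under eq_bigr do rewrite mulr_sumr.
rewrite (exchange_big_dep (fun F : {set {set T}} => F \subset G)) /=; last first.
  by move=> H F /andP[/eqP<- _] sF; apply: subset_trans sF (subsetUl _ _).
rewrite fk_poly_eval; apply: eq_bigr => F sFG.
rewrite -mulr_suml; under eq_bigl do rewrite -andbA.
by rewrite sum_partial_orientations // mulrCA -exprMn mulN1r mulrC natz.
Qed.

End Colourings.

Theorem proposition4p7 (T : finType) (G : sgraph T) :
  (forall (x : nat) (y : int), -1 <= y ->
     (fk_poly G).[- x%:Z, y] =
     \sum_(t in OPC G x (absz (y + 1)%R)) (-1) ^+ cc (gr0 (opc_graph t)))
  /\
  (forall (x : nat) (y : int), 1 <= y ->
     (fk_poly G).[- x%:Z, - y] =
     \sum_(t in OPC G x (absz (y - 1)%R))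
        (-1) ^+ (cc (gr0 (opc_graph t)) + opc_ncoloured t)).
Proof.
split=> x y y_ge.
  have /gez0_abs ey : 0 <= y + 1 by rewrite -lerBlDr sub0r.
  have -> : y = 1 *+ absz (y + 1) - 1 by rewrite -natz in ey; rewrite ey addrK.
  rewrite -sum_OPC addrNK natz absz_nat; apply: eq_bigr => t _.
  by rewrite expr1n mulr1.
have /gez0_abs ey : 0 <= y - 1 by rewrite subr_ge0.
have -> : - y = (-1) *+ absz (y - 1) - 1.
  by rewrite mulNrn; rewrite -natz in ey; rewrite ey opprB addrAC subrr sub0r.
by rewrite -sum_OPC; apply: eq_bigr => t _; rewrite exprD.
Qed.
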